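(* Let $\mu\ge1$ and $m\ge1$ be integers. Then, as formal power series in $t$, $$\sum_{n=0}^\infty B_{n,\le m}^{(\mu)}\frac{t^n}{n!}=\frac{\mathrm{Li}_\mu\bigl(1-E_m(-t)\bigr)}{1-E_m(-t)} \quad\text{and}\quad \sum_{n=0}^\infty B_{n,\ge m}^{(\mu)}\frac{t^n}{n!}=\frac{\mathrm{Li}_\mu\bigl(E_{m-1}(-t)-e^{-t}\bigr)}{E_{m-1}(-t)-e^{-t}},$$ where for a power series $z$ with zero constant term, $\mathrm{Li}_\mu(z)/z$ means $\sum_{k\ge0} z^k/(k+1)^\mu$.
   Context: $E_m(t)=\sum_{k=0}^m \frac{t^k}{k!}$ (so $E_0(t)=1$). $\mathrm{Li}_\mu(z)=\sum_{j\ge1} z^j/j^\mu$ is the polylogarithm. For integers $n,k\ge0$, $m\ge1$, $\left\{ {n \atop k} \right\}_{\le m}$ (resp. $\left\{ {n \atop k} \right\}_{\ge m}$) is the number of partitions of an $n$-element set into $k$ nonempty blocks each of size at most $m$ (resp. at least $m$), with the value $1$ for $n=k=0$. The restricted and associated poly-Bernoulli numbers are $$B_{n,\le m}^{(\mu)}=\sum_{k=0}^n(-1)^{n-k}\frac{k!}{(k+1)^\mu}\left\{ {n \atop k} \right\}_{\le m},\qquad B_{n,\ge m}^{(\mu)}=\sum_{k=0}^n(-1)^{n-k}\frac{k!}{(k+1)^\mu}\left\{ {n \atop k} \right\}_{\ge m}\qquad(n\ge0).$$ *)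

(* Defs.v *)
From mathcomp Require Import all_boot all_order all_algebra.
Set Implicit Arguments. Unset Strict Implicit. Unset Printing Implicit Defensive.
Import GRing.Theory.
Local Open Scope ring_scope.

(* A formal power series over the rationals is its coefficient sequence;
   equality of series is coefficientwise equality [=1]. *)
Definition fps := nat -> rat.

Definition fps_one : fps := fun n => (n == 0%N)%:R.
Definition fps_sub (f g : fps) : fps := fun n => f n - g n.
Definition fps_mul (f g : fps) : fps :=
  fun n => \sum_(i < n.+1) f i * g (n - i)%N.
Definition fps_exp (f : fps) (k : nat) : fps := iter k (fps_mul f) fps_one.

(* f(-t) *)
Definition fps_negvar (f : fps) : fps := fun n => (-1) ^+ n * f n.

(* \sum_(k >= 0) c_k z^k, for z with zero constant term: the powers z^k with
   k > n do not contribute to the coefficient of t^n, see [fps_comp_cvg]. *)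
Definition fps_comp (c z : fps) : fps :=
  fun n => \sum_(k < n.+1) c k * fps_exp z k n.

Definition expseries : fps := fun k => (k`!%:R)^-1.
Definition E_ (m : nat) : fps := fun k => if (k <= m)%N then (k`!%:R)^-1 else 0.

Definition polylog (mu : nat) : fps :=
  fun j => if j is 0 then 0 else (j%:R ^+ mu)^-1.

(* Li_mu(z) / z := \sum_(k >= 0) z^k / (k+1)^mu *)
Definition polylog_div (mu : nat) (z : fps) : fps :=
  fps_comp (fun k => (k.+1%:R ^+ mu)^-1) z.

Definition egf (a : nat -> rat) : fps := fun n => a n / n`!%:R.

(* [partition] already requires the blocks to be nonempty. *)
Definition stirling2_le (m n k : nat) : nat :=
  #|[set P : {set {set 'I_n}} | [&& partition P [set: 'I_n], #|P| == k
       & [forall B in P, (#|B| <= m)%N]]]|.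
Definition stirling2_ge (m n k : nat) : nat :=
  #|[set P : {set {set 'I_n}} | [&& partition P [set: 'I_n], #|P| == k
       & [forall B in P, (m <= #|B|)%N]]]|.

Definition polyBernoulli_le (mu m n : nat) : rat :=
  \sum_(k < n.+1)
    (-1) ^+ (n - k) * (k`!%:R / k.+1%:R ^+ mu) * (stirling2_le m n k)%:R.
Definition polyBernoulli_ge (mu m n : nat) : rat :=
  \sum_(k < n.+1)
    (-1) ^+ (n - k) * (k`!%:R / k.+1%:R ^+ mu) * (stirling2_ge m n k)%:R.

Lemma fps_exp_val (z : fps) k n : z 0%N = 0 -> (n < k)%N -> fps_exp z k n = 0.
Proof.
move=> z0; elim: k n => // k IH n ltnk.
change (fps_mul z (fps_exp z k) n = 0); apply: big1 => -[[|i] lti] _ /=.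
  by rewrite z0 mul0r.
rewrite IH ?mulr0 //.
by case: n ltnk lti => // n ltnk lti; rewrite subSS (leq_ltn_trans (leq_subr _ _)).
Qed.

(* [fps_comp c z] is the t-adic limit of the partial sums of \sum_k c_k z^k. *)
Lemma fps_comp_cvg (c z : fps) n N : z 0%N = 0 -> (n < N)%N ->
  \sum_(k < N) c k * fps_exp z k n = fps_comp c z n.
Proof.
move=> z0 ltnN; rewrite /fps_comp [RHS](big_ord_widen N (fun k => c k * fps_exp z k n)) //.
rewrite [RHS]big_mkcond /=; apply: eq_bigr => k _.
by case: ltnP => // ltnk; rewrite fps_exp_val ?mulr0.
Qed.

Lemma mul_polylog_div mu (z : fps) : z 0%N = 0 ->
  fps_mul z (polylog_div mu z) =1 fps_comp (polylog mu) z.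
Proof.
move=> z0 n; rewrite -(@fps_comp_cvg _ _ n n.+2) // big_ord_recl /= mul0r add0r.
under [RHS]eq_bigr => k _ do rewrite {1}/fps_mul mulr_sumr.
rewrite exchange_big /=; apply: eq_bigr => i _.
rewrite /polylog_div -(@fps_comp_cvg _ _ _ n.+1) ?ltnS ?leq_subr // mulr_sumr.
by apply: eq_bigr => k _; rewrite mulrCA.
Qed.

Lemma stirling2_le00 m : stirling2_le m 0 0 = 1%N.
Proof.
rewrite /stirling2_le -(cards1 (set0 : {set {set 'I_0}})); apply: eq_card => P.
rewrite !inE cards_eq0; case: eqP => [->|_]; last by rewrite andbF.
rewrite /partition /cover /trivIset /cover !big_set0 cards0 eqxx inE /= andbT.
apply/andP; split; first by apply/eqP/setP => -[].
by apply/forallP => B; rewrite inE.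
Qed.

Lemma stirling2_ge00 m : stirling2_ge m 0 0 = 1%N.
Proof.
rewrite /stirling2_ge -(cards1 (set0 : {set {set 'I_0}})); apply: eq_card => P.
rewrite !inE cards_eq0; case: eqP => [->|_]; last by rewrite andbF.
rewrite /partition /cover /trivIset /cover !big_set0 cards0 eqxx inE /= andbT.
apply/andP; split; first by apply/eqP/setP => -[].
by apply/forallP => B; rewrite inE.
Qed.

(* Main.v *)
Require Import Defs.
From mathcomp Require Import all_boot all_order all_algebra.
From mathcomp Require Import ring.
Set Implicit Arguments.
Unset Strict Implicit.
Unset Printing Implicit Defensive.
Import GRing.Theory Num.Theory.
Local Open Scope ring_scope.

(** Let [a] be the set of allowed block sizes, S(n, k) the number of partitions
    of an n-set into k blocks of allowed sizes, and
    w = \sum_(j >= 1, a j) t^j / j!.  Counting the pairs (partition of an n-set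
    into k+1 allowed blocks, distinguished block) in two ways gives
    (k+1) S(n, k+1) = \sum_(j >= 1, a j) C(n, j) S(n-j, k); this is the
    recursion w^(k+1) = w * w^k, so k! S(n, k) / n! is the coefficient of t^n
    in w^k.  Hence the coefficient of t^n in (- w(-t))^k is
    (-1)^(n-k) k! S(n, k) / n!, and the two series substituted into Li_mu(z) / z
    are z = - w(-t) for the sizes <= m and for the sizes >= m. *)

Lemma natr_fact_neq0 (R : numDomainType) n : n`!%:R != 0 :> R.
Proof. by rewrite pnatr_eq0 -lt0n fact_gt0. Qed.

Lemma signr_subn (R : pzRingType) k n :
  (k <= n)%N -> (-1) ^+ (n - k) = (-1) ^+ k * (-1) ^+ n :> R.
Proof. by move=> lekn; rewrite -{2}(subnKC lekn) exprD signrMK. Qed.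

Lemma sum_subset_card (V : nmodType) (T : finType) (A : {set T})
    (F : nat -> V) :
  \sum_(B : {set T} | B \subset A) F #|B| =
  \sum_(j < #|A|.+1) F j *+ 'C(#|A|, j).
Proof.
have card_inord (B : {set T}) :
    B \subset A -> (inord #|B| : 'I_#|A|.+1) = #|B| :> nat.
  by move=> sBA; rewrite inordK // ltnS subset_leq_card.
rewrite (partition_big (fun B : {set T} => inord #|B| : 'I_#|A|.+1) predT) //=.
apply: eq_bigr => j _; rewrite -cards_draws -sumr_const big_set /=.
apply: eq_big => [B|B /andP[sBA /eqP <-]]; last by rewrite card_inord.
by apply: andb_id2l => sBA; rewrite -(inj_eq val_inj) /= card_inord.
Qed.

Lemma fps_expS (f : fps) k : fps_exp f k.+1 = fps_mul f (fps_exp f k).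
Proof. by []. Qed.

Lemma eq_fps_exp (f g : fps) k : f =1 g -> fps_exp f k =1 fps_exp g k.
Proof.
move=> eqfg; elim: k => // k IHk n; rewrite !fps_expS.
by apply: eq_bigr => i _; rewrite eqfg IHk.
Qed.

Lemma eq_fps_comp (c f g : fps) : f =1 g -> fps_comp c f =1 fps_comp c g.
Proof.
by move=> eqfg n; apply: eq_bigr => k _; rewrite (eq_fps_exp k eqfg).
Qed.

Lemma fps_exp_rescale (f : fps) (b x : rat) k n :
  fps_exp (fun j => b * x ^+ j * f j) k n = b ^+ k * x ^+ n * fps_exp f k n.
Proof.
elim: k n => [|k IHk] n.
  by rewrite /fps_exp /= /fps_one; case: n => [|n]; rewrite ?mul1r ?mulr0.
rewrite !fps_expS mulr_sumr; apply: eq_bigr => -[i /= lein] _.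
by rewrite IHk exprS -[in RHS](subnKC (lein : (i <= n)%N)) exprD addKn; ring.
Qed.

Definition fps_opp_negvar (f : fps) : fps := fun n => - fps_negvar f n.

Lemma fps_exp_opp_negvar (f : fps) k n : (k <= n)%N ->
  fps_exp (fps_opp_negvar f) k n = (-1) ^+ (n - k) * fps_exp f k n.
Proof.
move=> lekn; rewrite signr_subn // -fps_exp_rescale; apply: eq_fps_exp => j.
by rewrite -mulrA mulN1r.
Qed.

Definition egf_coef (f : fps) (n : nat) : rat := n`!%:R * f n.

Lemma egfK a : egf_coef (egf a) =1 a.
Proof. by move=> n; rewrite /egf_coef mulrC divfK ?natr_fact_neq0. Qed.

Lemma egf_coefK f : egf (egf_coef f) =1 f.
Proof.
by move=> n; rewrite /egf /egf_coef mulrAC mulfV ?natr_fact_neq0 ?mul1r.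
Qed.

Lemma egf_coef_mul (f g : fps) (T : finType) (A : {set T}) :
  egf_coef (fps_mul f g) #|A| =
  \sum_(B : {set T} | B \subset A) egf_coef f #|B| * egf_coef g #|A :\: B|.
Proof.
transitivity (\sum_(B : {set T} | B \subset A)
    egf_coef f #|B| * egf_coef g (#|A| - #|B|)); last first.
  by apply: eq_bigr => B sBA; rewrite cardsD (setIidPr sBA).
rewrite (sum_subset_card A (fun j => egf_coef f j * egf_coef g (#|A| - j))).
rewrite [LHS]mulr_sumr; apply: eq_bigr => -[j /= lejA] _.
rewrite /egf_coef -(bin_fact (lejA : (j <= #|A|)%N)) !natrM -mulr_natr.
by ring.
Qed.

Section BlockPartitions.

Variables (T : finType) (p : pred {set T}).
Implicit Types (A B : {set T}) (P : {set {set T}}).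

Definition block_partitions A (k : nat) : {set {set {set T}}} :=
  [set P | [&& partition P A, #|P| == k & [forall B in P, p B]]].

Lemma card_block_partitions0 A : #|block_partitions A 0| = (A == set0).
Proof.
have [->|A_neq0] := eqVneq A set0.
  transitivity #|[set (set0 : {set {set T}})]|; last by rewrite cards1.
  apply: eq_card => P; rewrite !inE partition_set0 cards_eq0.
  by case: eqP => //= ->; apply/forall_inP => B; rewrite inE.
apply/eqP; rewrite cards_eq0; apply/eqP/setP => P; rewrite !inE cards_eq0.
apply/negP => /and3P[/cover_partition coverP /eqP P0 _].
by move: A_neq0; rewrite -coverP P0 /cover big_set0 eqxx.
Qed.

Lemma notin_partitionD P A B : partition P (A :\: B) -> B \notin P.
Proof.
move=> partP; apply/negP => BP; have /negP[] := partition_neq0 partP BP.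
have := partitionS partP BP; rewrite subsetD => /andP[_].
by rewrite -setI_eq0 setIid.
Qed.

Lemma partition_setU1 P A B :
    B != set0 -> B \subset A -> B \notin P ->
  partition (B |: P) A = partition P (A :\: B).
Proof.
move=> B_neq0 sBA BnP; apply/idP/idP => [partBP|partP].
  by rewrite -(setU1K BnP) partitionD1 ?setU11.
rewrite -(setID A B) (setIidPr sBA) partitionU1 //.
by rewrite disjoint_sym disjoints_subset setDE subsetIr.
Qed.

Lemma mem_block_partitions_setU1 P A B k :
    B != set0 -> B \subset A -> p B -> B \notin P ->
  (B |: P \in block_partitions A k.+1) = (P \in block_partitions (A :\: B) k).
Proof.
move=> B_neq0 sBA pB BnP.
rewrite !inE partition_setU1 // cardsU1 BnP add1n eqSS.
congr [&& _, _ & _]; apply/forall_inP/forall_inP => pP C CP.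
  by rewrite pP // setU1r.
by case/setU1P: CP => [->|/pP].
Qed.

Lemma card_block_partitions_mem A B k :
  #|[set P in block_partitions A k.+1 | B \in P]| =
  if [&& B \subset A, B != set0 & p B]
  then #|block_partitions (A :\: B) k| else 0%N.
Proof.
case: ifP => [/and3P[sBA B_neq0 pB]|/negP nB]; last first.
  apply/eqP; rewrite cards_eq0; apply/eqP/setP => P; rewrite !inE.
  apply/negP => /andP[/and3P[partP _ /forall_inP pP] BP]; apply: nB.
  by rewrite (partitionS partP BP) (partition_neq0 partP BP) pP.
have B_notin P : P \in block_partitions (A :\: B) k -> B \notin P.
  by rewrite inE => /and3P[/notin_partitionD].
have setU1_inj : {in block_partitions (A :\: B) k &, injective (setU [set B])}.
  move=> P Q /B_notin BnP /B_notin BnQ eqPQ.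
  by rewrite -(setU1K BnP) eqPQ setU1K.
rewrite -(card_in_imset setU1_inj); apply: eq_card => P; rewrite inE.
apply/andP/imsetP => [[PA BP]|[Q QA ->]].
  exists (P :\ B); last by rewrite setD1K.
  by rewrite -mem_block_partitions_setU1 ?setD1K // setD11.
by rewrite mem_block_partitions_setU1 ?B_notin ?setU11.
Qed.

Lemma mulSn_card_block_partitions A k :
  (k.+1 * #|block_partitions A k.+1| =
   \sum_(B : {set T} | [&& B \subset A, B != set0 & p B])
     #|block_partitions (A :\: B) k|)%N.
Proof.
transitivity (\sum_(P in block_partitions A k.+1) \sum_(B in P) 1)%N.
  rewrite mulnC -sum_nat_const; apply: eq_bigr => P.
  by rewrite sum1_card inE => /and3P[_ /eqP].
rewrite (exchange_big_dep predT) //= [RHS]big_mkcond /=.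
by apply: eq_bigr => B _; rewrite sum1dep_card card_block_partitions_mem.
Qed.

End BlockPartitions.

Section BlockSizes.

Variable a : pred nat.

Definition block_egf : fps := egf (fun j => ((0 < j)%N && a j)%:R).

Lemma fact_card_block_partitions (T : finType) (A : {set T}) k :
  (k`! * #|block_partitions (fun B => a #|B|) A k|)%:R =
  egf_coef (fps_exp block_egf k) #|A|.
Proof.
elim: k A => [|k IHk] A.
  rewrite card_block_partitions0 mul1n /egf_coef /fps_exp /= /fps_one cards_eq0.
  by case: eqP => [->|_]; rewrite ?cards0 ?mulr1 ?mulr0.
rewrite fps_expS egf_coef_mul factS mulnAC mulSn_card_block_partitions.
rewrite mulnC big_distrr natr_sum big_mkcondr; apply: eq_bigr => B _ /=.
by rewrite IHk egfK card_gt0; case: ifP; rewrite ?mul1r ?mul0r.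
Qed.

Definition restricted_stirling2 (n k : nat) : nat :=
  #|block_partitions (fun B : {set 'I_n} => a #|B|) [set: 'I_n] k|.

Lemma fact_restricted_stirling2 n k :
  k`!%:R * (restricted_stirling2 n k)%:R = egf_coef (fps_exp block_egf k) n.
Proof. by rewrite -natrM fact_card_block_partitions cardsT card_ord. Qed.

Lemma egf_restricted_stirling2 (c : fps) :
  egf (fun n => \sum_(k < n.+1)
         (-1) ^+ (n - k) * (k`!%:R * c k) * (restricted_stirling2 n k)%:R) =1
  fps_comp c (fps_opp_negvar block_egf).
Proof.
move=> n; rewrite -[RHS]egf_coefK; congr (_ / _).
rewrite /egf_coef mulr_sumr; apply: eq_bigr => -[k /= lekn] _.
transitivity ((-1) ^+ (n - k) * c k * (k`!%:R * (restricted_stirling2 n k)%:R)).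
  by ring.
by rewrite fact_restricted_stirling2 /egf_coef fps_exp_opp_negvar //; ring.
Qed.

End BlockSizes.

Lemma one_sub_negvar_E m :
  fps_sub fps_one (fps_negvar (E_ m)) =1
  fps_opp_negvar (block_egf (fun j => (j <= m)%N)).
Proof.
case=> [|j]; rewrite /fps_sub /fps_opp_negvar /fps_negvar /fps_one /E_.
  by rewrite /block_egf /egf /= mul1r invr1 subrr mul0r mulr0 oppr0.
by rewrite /block_egf /egf sub0r /=; case: ifP; rewrite ?mul1r ?mul0r.
Qed.

Lemma negvar_E_sub_expseries m : (0 < m)%N ->
  fps_sub (fps_negvar (E_ m.-1)) (fps_negvar expseries) =1
  fps_opp_negvar (block_egf (fun j => (m <= j)%N)).
Proof.
case: m => // m _ j.
rewrite /fps_sub /fps_opp_negvar /fps_negvar /E_ /expseries.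
rewrite /block_egf /egf /=; case: (leqP j m) => [_|ltmj].
  by rewrite andbF mul0r mulr0 subrr oppr0.
by rewrite (leq_ltn_trans _ ltmj) // mulr0 sub0r mul1r.
Qed.

Theorem theorem1 (mu m : nat) (hmu : (1 <= mu)%N) (hm : (1 <= m)%N) :
  (egf (polyBernoulli_le mu m) =1
     polylog_div mu (fps_sub fps_one (fps_negvar (E_ m)))) /\
  (egf (polyBernoulli_ge mu m) =1
     polylog_div mu (fps_sub (fps_negvar (E_ m.-1)) (fps_negvar expseries))).
Proof.
split=> n; rewrite /polylog_div.
  by rewrite (eq_fps_comp _ (one_sub_negvar_E m)) -egf_restricted_stirling2.
rewrite (eq_fps_comp _ (negvar_E_sub_expseries hm)).
by rewrite -egf_restricted_stirling2.
Qed.
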